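(* As formal power series in $q$, $$\sum_{n=1}^{\infty}K_{=}(n)q^n=\sum_{n=1}^{\infty}\frac{q^{2n-1}(q^{n+1};q)_{n-2}\,(q-q^{n})}{(q;q)_n}=\sum_{n=1}^{\infty}\frac{q^{2n}(q^{n+1};q)_{n-2}\,(1-q^{n-1})}{(q;q)_n},$$ where the $n=1$ term of each series on the right is $0$ (its factor $q-q^n$, respectively $1-q^{n-1}$, vanishes).
   Context: For a partition $\pi$ of a positive integer $n$, the Kimberling index is $K(\pi)=(\text{largest part of }\pi)-(\text{least part of }\pi)-(\text{number of parts of }\pi)$. $K_{=}(n)$ is the number of partitions $\pi$ of $n$ with $K(\pi)=0$. Notation: $(\alpha;q)_0=1$ and $(\alpha;q)_n=\prod_{j=0}^{n-1}(1-\alpha q^j)$ for $n\ge 1$. *)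

(* Defs.v *)
From HB Require Import structures.
From mathcomp Require Import all_boot all_order all_algebra.
From mathcomp Require Import boolp.

Set Implicit Arguments.
Unset Strict Implicit.
Unset Printing Implicit Defensive.

Import GRing.Theory.
Local Open Scope ring_scope.

(* A partition of n is its nonincreasing sequence of positive parts. *)
Definition is_partition (n : nat) (s : seq nat) : bool :=
  [&& sorted geq s, 0%N \notin s & sumn s == n].

(* The sequence being nonincreasing, its head is the largest part and its
   last item the least one; the value at [::] is never used for n >= 1. *)
Definition kimberling (s : seq nat) : int :=
  (head 0%N s)%:Z - (last 0%N s)%:Z - (size s)%:Z.

(* A partition of n has at most n parts, each at most n (see partition_bseq
   below), so all of them are found in the finite type n.-bseq 'I_n.+1. *)
Definition K_eq (n : nat) : nat :=
  #|[set s : n.-bseq 'I_n.+1 | is_partition n (map val s)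
                               & kimberling (map val s) == 0]|.

Lemma partition_bseq (n : nat) (s : seq nat) :
  is_partition n s -> exists t : n.-bseq 'I_n.+1, map val t = s.
Proof.
case/and3P=> _ s_pos /eqP sum_s.
have size_s : (size s <= n)%N.
  rewrite -{}sum_s; elim: s s_pos => //= x s IHs.
  rewrite inE negb_or eq_sym -lt0n => /andP[x0 /IHs le_s].
  by rewrite -add1n leq_add.
have le_s : all (fun x => x < n.+1)%N s.
  apply/allP=> x xs; rewrite ltnS -sum_s (perm_sumn (perm_to_rem xs)) /=.
  exact: leq_addr.
have size_t : (size (map (@inord n) s) <= n)%N by rewrite size_map.
exists (Bseq size_t) => /=; rewrite -map_comp map_id_in // => x xs /=.
by rewrite inordK //; apply: (allP le_s).
Qed.

Section FPS.
Variable R : comUnitRingType.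

(* The ring R[[q]]; a series is the sequence of its coefficients. *)
Record fps := Fps { fps_coef : nat -> R }.
Implicit Types a b c : fps.
Local Notation "a `[ n ]" := (fps_coef a n) (at level 2, format "a `[ n ]").

Lemma fpsP a b : (forall n, a`[n] = b`[n]) <-> a = b.
Proof.
split=> [|-> //]; case: a => a; case: b => b /= ab.
by congr Fps; apply: funext.
Qed.

HB.instance Definition _ := gen_eqMixin fps.
HB.instance Definition _ := gen_choiceMixin fps.

Definition fps_zero := Fps (fun=> 0).
Definition fps_opp a := Fps (fun n => - a`[n]).
Definition fps_add a b := Fps (fun n => a`[n] + b`[n]).

Fact fps_addA : associative fps_add.
Proof. by move=> a b c; apply/fpsP => n /=; rewrite addrA. Qed.
Fact fps_addC : commutative fps_add.
Proof. by move=> a b; apply/fpsP => n /=; rewrite addrC. Qed.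
Fact fps_add0 : left_id fps_zero fps_add.
Proof. by move=> a; apply/fpsP => n /=; rewrite add0r. Qed.
Fact fps_addN : left_inverse fps_zero fps_opp fps_add.
Proof. by move=> a; apply/fpsP => n /=; rewrite addNr. Qed.

HB.instance Definition _ :=
  GRing.isZmodule.Build fps fps_addA fps_addC fps_add0 fps_addN.

Definition fps_one := Fps (fun n => (n == 0%N)%:R).
Definition fps_mul a b := Fps (fun n => \sum_(j < n.+1) a`[j] * b`[n - j]).

Fact fps_mulC : commutative fps_mul.
Proof.
move=> a b; apply/fpsP => n /=; rewrite (reindex_inj rev_ord_inj) /=.
by apply: eq_bigr => j _; rewrite subSS subKn ?leq_ord // mulrC.
Qed.

Fact fps_mulA : associative fps_mul.
Proof.
move=> a b c; apply/fpsP => i; rewrite [RHS](_ : _ = (fps_mul c (fps_mul a b))`[i]);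
  last by rewrite fps_mulC.
rewrite /=.
pose coef3 j k := a`[j] * (b`[i - j - k] * c`[k]).
transitivity (\sum_(j < i.+1) \sum_(k < i.+1 | (k <= i - j)%N) coef3 j k).
  apply: eq_bigr => /= j _.
  rewrite [X in _ * X](_ : _ = (fps_mul b c)`[i - j]) // fps_mulC /=.
  rewrite big_distrr /= (big_ord_narrow_leq (leq_subr _ _)).
  by apply: eq_bigr => k _; rewrite /coef3 /= [c`[_] * _]mulrC.
rewrite (exchange_big_dep predT) //=; apply: eq_bigr => k _.
transitivity (\sum_(j < i.+1 | (j <= i - k)%N) coef3 j k).
  apply: eq_bigl => j; rewrite -ltnS -(ltnS j) -!subSn ?leq_ord //.
  by rewrite -subn_gt0 -(subn_gt0 j) -!subnDA addnC.
rewrite (big_ord_narrow_leq (leq_subr _ _)) big_distrr /=.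
by apply: eq_bigr => j _; rewrite /coef3 -!subnDA addnC mulrA mulrC.
Qed.

Fact fps_mul1 : left_id fps_one fps_mul.
Proof.
move=> a; apply/fpsP => n /=; rewrite big_ord_recl /= subn0 mul1r.
by rewrite big1 ?addr0 // => j _; rewrite mul0r.
Qed.

Fact fps_mulDl : left_distributive fps_mul fps_add.
Proof.
move=> a b c; apply/fpsP => n /=; rewrite -big_split /=.
by apply: eq_bigr => j _; rewrite mulrDl.
Qed.

Fact fps_one_neq0 : fps_one != 0.
Proof.
apply/eqP => /fpsP /(_ 0%N) /= /eqP.
by rewrite oner_eq0.
Qed.

HB.instance Definition _ := GRing.Zmodule_isComNzRing.Build fps
  fps_mulA fps_mulC fps_mul1 fps_mulDl fps_one_neq0.

(* The series that are invertible are those with an invertible constant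
   coefficient; the coefficients of 1/a are obtained by solving a * b = 1
   degree by degree. As for any unitRingType, non-units are their own
   (meaningless) inverse. *)
Definition fps_unit : pred fps := fun a => a`[0%N] \is a GRing.unit.

Fixpoint fps_inv_seq a (n : nat) : seq R :=
  if n is m.+1 then
    let s := fps_inv_seq a m in
    rcons s ((a`[0%N])^-1 * ((m == 0%N)%:R - \sum_(j < m) a`[m - j] * s`_j))
  else [::].

Definition fps_inv a : fps :=
  if fps_unit a then Fps (fun n => (fps_inv_seq a n.+1)`_n) else a.

Lemma size_fps_inv_seq a n : size (fps_inv_seq a n) = n.
Proof. by elim: n => //= n IHn; rewrite size_rcons IHn. Qed.

Lemma nth_fps_inv_seq a n j :
  (j < n)%N -> (fps_inv_seq a n)`_j = (fps_inv_seq a j.+1)`_j.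
Proof.
elim: n => // n IHn; rewrite ltnS leq_eqVlt => /predU1P[-> //|lt_jn].
by rewrite -IHn // [LHS]nth_rcons size_fps_inv_seq lt_jn.
Qed.

Fact fps_mulV : {in fps_unit, left_inverse 1 fps_inv *%R}.
Proof.
move=> a Ua; rewrite mulrC /fps_inv (_ : fps_unit a) //.
apply/fpsP => n; rewrite /= (reindex_inj rev_ord_inj) /= big_ord_recr /=.
rewrite subSS subnn.
rewrite nth_rcons size_fps_inv_seq subn0 ltnn eqxx mulVKr //.
rewrite [X in X + _](_ : _ = \sum_(j < n) a`[n - j] * (fps_inv_seq a n)`_j).
  by rewrite addrC subrK.
apply: eq_bigr => j _; rewrite subSS subKn; last exact: ltnW.
by rewrite (nth_fps_inv_seq _ (ltn_ord j)).
Qed.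

Fact fps_unitP a b : b * a = 1 -> fps_unit a.
Proof.
move=> /fpsP /(_ 0%N) /=; rewrite big_ord_recl big_ord0 addr0 => ba.
by apply/unitrPr; exists b`[0%N]; rewrite mulrC.
Qed.

Fact fps_inv_out : {in [predC fps_unit], fps_inv =1 id}.
Proof. by move=> a /negbTE nUa; rewrite /fps_inv [fps_unit a]nUa. Qed.

HB.instance Definition _ := GRing.ComNzRing_hasMulInverse.Build fps
  fps_mulV fps_unitP fps_inv_out.

Definition fps_X : fps := Fps (fun n => (n == 1%N)%:R).

(* The series f m0 + f (m0 + 1) + ... converges to S in the q-adic topology:
   each coefficient of the partial sums is eventually that of S. *)
Definition fps_has_sum (m0 : nat) (f : nat -> fps) (S : fps) : Prop :=
  forall i, exists N, forall k, (N <= k)%N ->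
    (\sum_(m0 <= n < k) f n)`[i] = S`[i].

Lemma fps_has_sum_unique m0 f S T :
  fps_has_sum m0 f S -> fps_has_sum m0 f T -> S = T.
Proof.
move=> fS fT; apply/fpsP => i; have [N fSi] := fS i; have [M fTi] := fT i.
by rewrite -(fSi (maxn N M)) ?leq_maxl // fTi ?leq_maxr.
Qed.

End FPS.

Notation "''q'" := (fps_X int) (at level 0) : ring_scope.

Definition qpoch (A : comNzRingType) (a q : A) (n : nat) : A :=
  \prod_(j < n) (1 - a * q ^+ j).

(* So the divisions by (q; q)_n are genuine. *)
Lemma qpoch_unit (n : nat) : qpoch 'q 'q n \is a GRing.unit.
Proof.
apply: (big_ind (fun x => x \is a GRing.unit)) => [|x y Ux Uy|j _].
- exact: unitr1.
- by rewrite unitrM Ux.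
- by rewrite /in_mem /= /fps_unit /= big_ord_recl big_ord0 mul0r addr0.
Qed.

(* Main.v *)
(** A partition with [K = 0], [m] parts and least part [a] has largest part
    [a + m]; deleting one copy of each leaves an arbitrary nonincreasing
    sequence of [m - 2] integers in [[a, a + m]], and such sequences are counted
    by [q^(a(m - 2))] times a Gaussian binomial coefficient. Summing the
    geometric series over [a >= 1] gives the [m]-th term of the right-hand
    side. *)
Require Import Defs.
From mathcomp Require Import all_boot all_order all_algebra.
From mathcomp Require Import zify ring.

Local Open Scope ring_scope.

Import GRing.Theory.

(** * Nonincreasing sequences with entries in an interval *)

(** The sequences have length [k] and entries in [a, a + b]: either the head is [a + b], or the
    upper bound drops by one. The nested fixpoints allow either [k] or [b] to decrease. *)
Fixpoint box_seqs (a b : nat) {struct b} : nat -> seq (seq nat) :=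
  fix box_b (k : nat) : seq (seq nat) :=
    if k is k'.+1 then
      map (cons (a + b)%N) (box_b k')
      ++ (if b is b'.+1 then box_seqs a b' k else [::])
    else [:: [::]].

Lemma box_seqsS a b k :
  box_seqs a b k.+1 = map (cons (a + b)%N) (box_seqs a b k)
    ++ (if b is b'.+1 then box_seqs a b' k.+1 else [::]).
Proof. by case: b. Qed.

Lemma box_seqs0 a b : box_seqs a b 0 = [:: [::]].
Proof. by case: b. Qed.

Lemma mem_map_cons (T : eqType) (x y : T) s (l : seq (seq T)) :
  (x :: s \in map (cons y) l) = (x == y) && (s \in l).
Proof.
apply/mapP/andP => [[t tl [-> ->]]|[/eqP-> sl]]; first by rewrite eqxx.
by exists s.
Qed.

Lemma sorted_geq_cons x s :
  sorted geq (x :: s) = all (geq x) s && sorted geq s.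
Proof. by rewrite /= path_sortedE // => ? ? ? /=; lia. Qed.

Lemma mem_box_seqs a b k s :
  (s \in box_seqs a b k)
  = [&& size s == k, all (fun x => a <= x <= a + b)%N s & sorted geq s].
Proof.
elim: b k s => [|b IHb]; elim=> [|k IHk] [|x s]; rewrite ?box_seqs0 //.
- by rewrite box_seqsS cats0; apply/mapP => -[].
- rewrite box_seqsS cats0 mem_map_cons IHk addn0 sorted_geq_cons /= eqSS.
  rewrite -eqn_leq [a == x]eq_sym; case: eqP => [->|] /=; last by rewrite andbF.
  case: (size s == k) => //=.
  case: (boolP (all _ s)) => //= /allP sa.
  suff -> : all (geq a) s by [].
  by apply/allP => y /sa /=; lia.
- rewrite box_seqsS mem_cat IHb /= orbF.
  by apply/mapP => -[].
rewrite box_seqsS mem_cat mem_map_cons IHk IHb sorted_geq_cons /= eqSS.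
case: (size s == k); rewrite /= ?andbF //.
case: (sorted geq s); rewrite /= ?andbF // ?andbT.
apply/orP/idP => [[/andP[/eqP-> sa]|/andP[/andP[ax sb] sx]]|/andP[/andP[ax sb] sx]].
- rewrite sa leq_addr leqnn /=; apply/allP => y /(allP sa) /=; lia.
- rewrite sx andbT; apply/andP; split; first by lia.
  by apply/allP => y /(allP sb) /=; lia.
case: eqP => xab; [by left | right].
rewrite sx andbT; apply/andP; split; first by lia.
apply/allP => y ys; move: (allP sb y ys) (allP sx y ys) => /=; lia.
Qed.

Lemma uniq_box_seqs a b k : uniq (box_seqs a b k).
Proof.
elim: b k => [|b IHb]; elim=> [|k IHk]; rewrite ?box_seqs0 // box_seqsS.
  by rewrite cats0 map_inj_uniq // => ? ? [].
rewrite cat_uniq IHb map_inj_uniq ?IHk /= ?andbT; last by move=> ? ? [].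
(* The two halves are disjoint: heads in the first are [a + b.+1], above every entry in the
   second. *)
apply/hasPn => -[|x s]; rewrite mem_box_seqs //= mem_map_cons.
by move=> /and3P[_ /andP[? _] _]; apply/negP => /andP[/eqP]; lia.
Qed.

(** * Gaussian binomial coefficients *)

Lemma qpochS (A : comNzRingType) (a x : A) n :
  qpoch a x n.+1 = qpoch a x n * (1 - a * x ^+ n).
Proof. by rewrite /qpoch big_ord_recr. Qed.

Lemma qpochD (A : comNzRingType) (x : A) m k :
  qpoch x x (m + k) = qpoch x x m * qpoch (x ^+ (m + 1)) x k.
Proof.
rewrite /qpoch big_split_ord; congr (_ * _); apply: eq_bigr => j _ /=.
by rewrite -exprS -exprD -addnS -addnA add1n.
Qed.

Lemma sum_box_seqs (A : comNzRingType) (x : A) a b k :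
  (\sum_(t <- box_seqs a b k) x ^+ sumn t) * qpoch x x b * qpoch x x k
  = x ^+ (a * k) * qpoch x x (b + k).
Proof.
have q0 : qpoch x x 0 = 1 by rewrite /qpoch big_ord0.
have rec c l : \sum_(t <- map (cons c) l) x ^+ sumn t
    = x ^+ c * \sum_(t <- l) x ^+ sumn t.
  by rewrite big_map big_distrr; apply: eq_bigr => t _; rewrite /= exprD.
elim: b k => [|b IHb]; elim=> [|k IHk]; rewrite ?box_seqs0.
- by rewrite big_seq1 q0 muln0 /= expr0 ?q0 !mulr1.
- rewrite box_seqsS cats0 rec !add0n addn0 mulnS exprD qpochS !q0.
  by move: IHk; rewrite add0n q0; move: (\sum_(_ <- _) _) => B IHk; ring: IHk.
- by rewrite big_seq1 q0 muln0 addn0 /= expr0 mulr1.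
rewrite box_seqsS big_cat rec /=; move: (IHb k.+1) IHk; rewrite addSnnS.
set B := \sum_(t <- box_seqs a b k.+1) _; set C := \sum_(t <- box_seqs a b.+1 k) _.
rewrite mulnS addSn !qpochS !exprD !exprS => HB HC.
(* After both induction hypotheses there remains x^(b+1) (1 - x^(k+1)) + (1 - x^(b+1)) = 1 -
   x^(b+k+2). *)
transitivity (x ^+ a * (x * x ^+ b) * (1 - x * x ^+ k)
    * (C * (qpoch x x b * (1 - x * x ^+ b)) * qpoch x x k)
  + (1 - x * x ^+ b) * (B * qpoch x x b * (qpoch x x k * (1 - x * x ^+ k)))).
  by ring.
by rewrite HB HC; ring.
Qed.

(** * Partitions of Kimberling index 0, by number of parts and least part *)

Definition kimberling_cell (n m a : nat) : seq (seq nat) :=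
  [seq (a + m)%N :: rcons t a | t <- box_seqs a m (m - 2)
                              & (sumn t + (a + (a + m)) == n)%N].

Definition kimberling0_partition n s := is_partition n s && (kimberling s == 0).

Lemma mem_kimberling_cell n m a s : (1 < m)%N -> (0 < a)%N ->
  (s \in kimberling_cell n m a)
  = [&& kimberling0_partition n s, size s == m & last 0%N s == a].
Proof.
move=> m1 a0; apply/mapP/and3P => [[t]|[/andP[]]].
  rewrite mem_filter mem_box_seqs => /and4P[/eqP <- /eqP st ta tx] ->.
  rewrite /kimberling0_partition /kimberling /is_partition /= last_rcons size_rcons.
  rewrite inE mem_rcons inE st; split=> //; last by apply/eqP; lia.
  apply/andP; split; last by apply/eqP; lia.
  apply/and3P; split; last by rewrite -cats1 sumn_cat /=; lia.
  - rewrite path_sortedE => [|? ? ? /=]; last by lia.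
    rewrite all_rcons -rev_sorted rev_rcons /= path_sortedE => [|? ? ? /=]; last by lia.
    rewrite all_rev rev_sorted tx andbT leq_addr /=.
    by apply/andP; split; apply/allP => y /(allP ta) /=; lia.
  - rewrite !negb_or; apply/and3P; split; [lia | lia |].
    by apply/negP => /(allP ta) /=; lia.
case/and3P; case: s => [|x s]; first by move=> _ _ _ _ /eqP sm; rewrite -sm in m1.
case/lastP: s => [|s y].
  by move=> _ _ _ _ /eqP sm; rewrite -sm in m1.
rewrite /kimberling /= last_rcons size_rcons inE mem_rcons inE.
rewrite path_sortedE => [|? ? ? /=]; last by lia.
rewrite all_rcons -rev_sorted rev_rcons /= path_sortedE => [|? ? ? /=]; last by lia.
rewrite all_rev rev_sorted -cats1 sumn_cat /=.
move=> /and3P[/andP[xy xs] ys ss] _ /eqP sn /eqP K /eqP sm /eqP ya.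
(* The witness is what lies between the largest part [x] and the least part [y]; [K] forces
   [x = a + m]. *)
exists s; last by rewrite cats1 ya; congr (_ :: _); lia.
rewrite mem_filter mem_box_seqs ss andbT; apply/and3P; split; [lia | by rewrite -sm !subSS subn0 |].
by apply/allP => z zs; move: (allP xs z zs) (allP ys z zs) => /=; lia.
Qed.

Lemma uniq_kimberling_cell n m a : uniq (kimberling_cell n m a).
Proof.
rewrite map_inj_uniq ?filter_uniq ?uniq_box_seqs // => s t [].
exact: rcons_injl.
Qed.

(** A single part gives index -1, so index 0 requires two parts. The bounds keep both statistics
    inside the summation ranges of [K_eqE]. *)
Lemma kimberling0_partition_bounds n s : (0 < n)%N ->
  kimberling0_partition n s -> (1 < size s <= n)%N && (0 < last 0%N s <= n)%N.
Proof.
move=> n0 /andP[P]; have [t ts] := partition_bseq P.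
have sn : (size s <= n)%N by rewrite -ts size_map; case: (t).
case/and3P: P => _ s0 /eqP sn'; subst n.
case: s {t ts} s0 sn n0 => [//|x s]; rewrite /kimberling => s0 sn n0.
have ls : last 0%N (x :: s) \in x :: s by rewrite /= mem_last.
have l0 : last 0%N (x :: s) != 0%N by apply: contraNneq s0 => <-.
have : (last 0%N (x :: s) <= sumn (x :: s))%N.
  by rewrite (perm_sumn (perm_to_rem ls)) /= leq_addr.
case: s {s0 ls} sn l0 n0 => [|y s] //=; lia.
Qed.

Lemma sum_eq_nat c d x : (\sum_(c <= m < d) (x == m) = (c <= x < d))%N.
Proof.
rewrite -mem_index_iota -(count_uniq_mem x (iota_uniq c (d - c) : uniq (index_iota c d))).
by rewrite -sum1_count [RHS]big_mkcond; apply: eq_bigr => m _; rewrite /= eq_sym; case: eqP.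
Qed.

(** Each partition lies in exactly one cell, and its number of parts and least part are at most [n],
    hence below [N]. *)
Lemma K_eqE n N : (0 < n < N)%N ->
  K_eq n = (\sum_(2 <= m < N) \sum_(1 <= a < N) size (kimberling_cell n m a))%N.
Proof.
case/andP=> n0 nN; pose f (s : n.-bseq 'I_n.+1) : seq nat := map val s.
have f_inj : injective f by move=> s t /(inj_map val_inj) /val_inj.
pose A := [set s | kimberling0_partition n (f s)].
pose P := map f (enum A).
have uP : uniq P by rewrite map_inj_uniq ?enum_uniq.
have memP s : (s \in P) = kimberling0_partition n s.
  apply/mapP/idP => [[t]|Ps]; first by rewrite mem_enum inE => ? ->.
  have [/partition_bseq[t ts] _] := andP Ps.
  by exists t; rewrite // mem_enum inE /f ts.
transitivity (size P).
  by rewrite size_map -cardE; apply: eq_card => s; rewrite !inE.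
have cellE m a : (1 < m)%N -> (0 < a)%N -> size (kimberling_cell n m a)
    = (\sum_(s <- P) (size s == m) * (last 0 s == a))%N.
  move=> m1 a0; rewrite -sum1_size.
  transitivity (size [seq s <- P | (size s == m) && (last 0%N s == a)]).
    rewrite sum1_size; apply/perm_size/uniq_perm; rewrite ?filter_uniq //.
      exact: uniq_kimberling_cell.
    by move=> s; rewrite mem_kimberling_cell // mem_filter memP andbC.
  rewrite size_filter -sum1_count big_mkcond.
  by apply: eq_bigr => s _; case: eqP => _; case: eqP.
(* With cell sizes written as sums of indicators over [P], the sum over [a] collapses first, then
   the sum over [m]. *)
rewrite (eq_big_nat _ _ (F2 := fun m => \sum_(s <- P) (size s == m)))%N; last first.
  move=> m /andP[m1 _].
  rewrite (eq_big_nat _ _ (F2 := fun a => \sum_(s <- P) (size s == m) * (last 0 s == a)))%N.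
    rewrite exchange_big /= big_seq [RHS]big_seq; apply: eq_bigr => s.
    rewrite memP => /(kimberling0_partition_bounds _ _ n0) /andP[_ /andP[l0 ln]].
    by rewrite -big_distrr /= sum_eq_nat l0 (leq_ltn_trans ln) // muln1.
  by move=> a /andP[a0 _]; rewrite cellE.
rewrite exchange_big /= -sum1_size big_seq [RHS]big_seq; apply: eq_bigr => s.
rewrite memP => /(kimberling0_partition_bounds _ _ n0) /andP[/andP[s1 sn] _].
by rewrite sum_eq_nat s1 (leq_ltn_trans sn).
Qed.

(** * Coefficients of the series and the geometric sum over the least part *)

Lemma fps_coef_sum (R : comUnitRingType) (I : Type) (r : seq I) (P : pred I)
    (F : I -> fps R) i :
  fps_coef (\sum_(j <- r | P j) F j) i = \sum_(j <- r | P j) fps_coef (F j) i.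
Proof. exact: (big_morph (fun a : fps R => fps_coef a i)). Qed.

Lemma fps_coef_XnM (R : comUnitRingType) k (a : fps R) i :
  fps_coef (fps_X R ^+ k * a) i = if (i < k)%N then 0 else fps_coef a (i - k).
Proof.
elim: k i => [|k IHk] i; first by rewrite mul1r subn0.
rewrite exprS -mulrA; case: i => [|i].
  by rewrite /= big_ord_recl big_ord0 mul0r addr0.
rewrite ltnS subSS -IHk; move: (_ ^+ k * a) => c /=.
rewrite big_ord_recl mul0r add0r big_ord_recl mul1r subSS subn0.
by rewrite big1 ?addr0 // => j _; rewrite mul0r.
Qed.

Lemma fps_coef_Xn (R : comUnitRingType) k i :
  fps_coef (fps_X R ^+ k) i = (i == k)%:R.
Proof.
rewrite -[fps_X R ^+ k]mulr1 fps_coef_XnM /= subn_eq0.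
by case: ltngtP.
Qed.

Definition Kseries_term (m : nat) : fps int :=
  'q ^+ (2 * m) * qpoch ('q ^+ (m + 1)) 'q (m - 2) * (1 - 'q ^+ (m - 1))
  / qpoch 'q 'q m.

Lemma Kseries_term1 : Kseries_term 1 = 0.
Proof. by rewrite /Kseries_term subrr mulr0 mul0r. Qed.

Lemma fps_coef_Kseries_term m i :
  (i < 2 * m)%N -> fps_coef (Kseries_term m) i = 0.
Proof. by move=> im; rewrite /Kseries_term -!mulrA fps_coef_XnM im. Qed.

(** The factor 1 - q^m undoes the geometric series over the least part; written as a difference, the
    identity telescopes in [a]. The least part is [a.+1], and the exponent restores the two deleted
    parts. *)
Lemma Kseries_term_box m a : (1 < m)%N ->
  'q ^+ (a * m) * Kseries_term m - 'q ^+ (a.+1 * m) * Kseries_term m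
  = \sum_(t <- box_seqs a.+1 m (m - 2)) 'q ^+ (sumn t + (a.+1 + (a.+1 + m))).
Proof.
case: m => [|[|m]] // _; rewrite [(m.+2 - 2)%N]subn0.
under eq_bigr do rewrite exprD.
rewrite -big_distrl /=; set B := \sum_(_ <- _) _.
have U := qpoch_unit.
(* In [sum_box_seqs], (q; q)_(2m+2) contains the factor (q; q)_(m+2), which cancels. *)
have BC : B * qpoch 'q 'q m = 'q ^+ (a.+1 * m) * qpoch ('q ^+ (m.+2 + 1)) 'q m.
  have := sum_box_seqs _ 'q a.+1 m.+2 m; rewrite -/B qpochD => HB.
  by apply: (mulIr (U m.+2)); rewrite mulrAC HB mulrA mulrAC.
have TD : Kseries_term m.+2 * qpoch 'q 'q m.+2
    = 'q ^+ (2 * m.+2) * qpoch ('q ^+ (m.+2 + 1)) 'q m * (1 - 'q ^+ m.+1).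
  by rewrite /Kseries_term mulrVK ?U // [(m.+2 - 2)%N]subn0.
(* Both denominators are cleared; [BC] and [TD] then reduce the claim to a polynomial identity. *)
apply: (mulIr (U m.+2)); apply: (mulIr (U m)).
move: BC TD; rewrite !qpochS.
move: B (Kseries_term _) (qpoch _ _ _) (qpoch _ _ _) => B T P C BC TD.
have -> : (a * m.+2 = a * m + a + a)%N by lia.
have -> : (a.+1 * m.+2 = a * m + a + a + m.+2)%N by lia.
have -> : (a.+1 + (a.+1 + m.+2) = a + a + m + 4)%N by lia.
move: BC TD; have -> : (a.+1 * m = a * m + m)%N by lia.
have -> : (2 * m.+2 = m + m + 4)%N by lia.
rewrite !exprS !exprD => BC TD.
rewrite -mulrBl -(mulrA _ T) TD [RHS]mulrAC [B * _ * C]mulrAC BC.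
have -> : 'q ^+ m.+2 = 'q * ('q * 'q ^+ m) by rewrite !exprS.
move: (fps_X int) ('q ^+ (a * m)) ('q ^+ a) ('q ^+ m) => x y z w.
ring.
Qed.

Lemma size_kimberling_cell n m a :
  (size (kimberling_cell n m a))%:R
  = fps_coef (\sum_(t <- box_seqs a m (m - 2)) 'q ^+ (sumn t + (a + (a + m)))) n.
Proof.
rewrite size_map size_filter -sum1_count natr_sum fps_coef_sum big_mkcond.
by apply: eq_bigr => t _; rewrite fps_coef_Xn eq_sym; case: eqP.
Qed.

(** Telescoping over [a] leaves the term minus q^((N-1)m) times itself, and the latter does not
    reach degree [n] because [n < N - 1]. *)
Lemma fps_coef_Kseries_term_cells m n N : (1 < m)%N -> (n.+1 < N)%N ->
  fps_coef (Kseries_term m) n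
  = (\sum_(1 <= a < N) size (kimberling_cell n m a))%:R.
Proof.
case: N => // N m1 nN; rewrite natr_sum big_add1 succnK.
under eq_bigr do rewrite size_kimberling_cell -Kseries_term_box //.
rewrite -fps_coef_sum.
under eq_bigr do rewrite -opprB.
rewrite sumrN telescope_sumr // opprB mul0n mul1r.
rewrite -[LHS]subr0; congr (_ - _); rewrite fps_coef_XnM ifT //.
by rewrite (leq_trans (nN : (n < N)%N)) // leq_pmulr // ltnW.
Qed.

(* For n = 1 the subtraction n - 2 is truncated to 0, which is harmless: the
   factor 'q - 'q ^+ n, resp. 1 - 'q ^+ (n - 1), vanishes. *)
Theorem mainTheorem1 :
  exists S : fps int,
    [/\ fps_has_sum 1 (fun n => (K_eq n)%:R * 'q ^+ n) S,
        fps_has_sum 1 (fun n =>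
          'q ^+ (2 * n - 1) * qpoch ('q ^+ (n + 1)) 'q (n - 2) * ('q - 'q ^+ n)
          / qpoch 'q 'q n) S
      & fps_has_sum 1 (fun n =>
          'q ^+ (2 * n) * qpoch ('q ^+ (n + 1)) 'q (n - 2)
          * (1 - 'q ^+ (n - 1)) / qpoch 'q 'q n) S].
Proof.
(* The factor [0 < n] discards the empty partition: [K_eq 0] is 1, but the series start at 1. *)
pose S : fps int := Fps (fun n => ((0 < n) * K_eq n)%:R).
have sumT : fps_has_sum 1 Kseries_term S.
  move=> n; exists n.+2 => N nN; rewrite fps_coef_sum [fps_coef S _]/=.
  case: n => [|n] in nN *.
    rewrite big_nat_cond big1 // => m /andP[/andP[m0 _] _].
    by rewrite fps_coef_Kseries_term // muln_gt0.
  (* Cells describe only [m > 1], so the zero term at [m = 1] is split off. *)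
  rewrite big_ltn; last by apply: leq_trans nN.
  rewrite Kseries_term1 add0r mul1n (@K_eqE _ N) ?(ltnW nN) // natr_sum.
  rewrite big_nat_cond [RHS]big_nat_cond; apply: eq_bigr => m /andP[/andP[m1 _] _].
  exact: fps_coef_Kseries_term_cells.
(* The last series is [sumT] up to unfolding [Kseries_term]. *)
exists S; split=> //.
- move=> n; exists n.+1 => N nN; rewrite fps_coef_sum [fps_coef S _]/=.
  under eq_bigr => m _ do rewrite mulr_natl.
  have coefMn (a : fps int) k : fps_coef (a *+ k) n = fps_coef a n *+ k.
    by elim: k => // k IHk; rewrite !mulrS -IHk.
  under eq_bigr => m _ do rewrite coefMn fps_coef_Xn.
  case: n => [|n] in nN coefMn *.
    rewrite big_nat_cond big1 // => m /andP[/andP[m0 _] _].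
    by rewrite (ltn_eqF m0) mul0rn.
  rewrite (bigD1_seq n.+1) ?iota_uniq ?mem_index_iota //= eqxx mul1n.
  by rewrite big1 ?addr0 // => m /negPf; rewrite eq_sym => ->; rewrite mul0rn.
- move=> n; have [M sumM] := sumT n; exists M => N /sumM <-.
  congr (fps_coef _ n); rewrite big_nat_cond [RHS]big_nat_cond.
  apply: eq_bigr => -[|m] /andP[/andP[// _ _] _].
  (* One factor q moves into the leading power; as the index is at least 1, [2 * m.+1 - 1] is not
     truncated. *)
  have -> : 'q - 'q ^+ m.+1 = 'q * (1 - 'q ^+ (m.+1 - 1)).
    by rewrite subn1 mulrBr mulr1 -exprS.
  rewrite /Kseries_term; have {2}-> : (2 * m.+1 = (2 * m.+1 - 1).+1)%N by lia.
  by rewrite exprSr mulrA; congr (_ * _ / _); rewrite mulrAC.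
Qed.
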